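(* There exist sets $B_0,B_1\subseteq\omega$ for which there is no set $A\subseteq\omega$ such that $B_0\leq_{\mathrm{ii}}A$ and $B_1\leq_{\mathrm{ii}}A$.
   Context: Sets are subsets of $\omega$ and are identified with their characteristic functions. For partial functions $f,g$ on $\omega$, $f\simeq g$ means $f(n)=g(n)$ for every $n$ in both domains. A partial oracle $(A)$ for a set $A$ is a set of triples $\langle n,x,l\rangle$ such that if $\langle n,0,l\rangle\in(A)$ for some $l$ then $n\notin A$, and if $\langle n,1,l\rangle\in(A)$ for some $l$ then $n\in A$. It is regarded as a partial function $(A):\omega\to\{0,1\}$ mapping $n$ to $x$ and taking $l$ steps to converge; its domain is the set of $n$ for which such $x,l$ exist. To query the $n$th bit of $(A)$ is to start a search for $x,l$ with $\langle n,x,l\rangle\in(A)$; while waiting, a computation may do other calculations and query other bits. A set $A$ is regarded as a partial oracle for itself that immediately halts on every input. $B\leq_{\mathrm{ii}}A$ (infinite-information reducibility) means: there is a Turing functional $\Phi$ such that for any partial oracle $(A)$ for $A$ with infinite domain, $\Phi^{(A)}\simeq B$ and $\Phi^{(A)}$ has infinite domain. *)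

(* Defs.v *)
From mathcomp Require Import all_boot.
From mathcomp Require Import boolp classical_sets functions cardinality.

Set Implicit Arguments.
Unset Strict Implicit.
Unset Printing Implicit Defensive.

Local Open Scope classical_set_scope.

(* A partial function from nat to T is represented by its graph. *)
Definition pfun (T : Type) := nat -> T -> Prop.

Definition pdom (T : Type) (f : pfun T) : set nat := [set n | exists y, f n y].

Definition pagree (T : Type) (f g : pfun T) : Prop :=
  forall n y z, f n y -> g n z -> y = z.

Definition charfun (B : set nat) : pfun nat := fun n y => y = (n \in B).

(* Oracle Turing machines.  The work tape is two-way infinite, over the
   alphabet {blank = false, 1 = true}.  The oracle tape is read-only and
   one-way infinite: cell 0 carries an end marker and cell c.+1 carries the
   truth value of "c belongs to the oracle".  The two heads move
   independently. *)

Inductive move := MoveLeft | Stay | MoveRight.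

Record oracle_machine := OracleMachine {
  nstates : nat;
  (* Arguments: current state ; scanned oracle cell, None being the end marker ;
     scanned work cell.  Result: next state ; symbol written on the work tape ;
     move of the work head ; move of the oracle head.  None means halt. *)
  transition : {ffun 'I_nstates.+1 * option bool * bool ->
                     option ('I_nstates.+1 * bool * move * move)}
}.

(* The cells to the left of the head (nearest first), the scanned cell, and the
   cells to the right of the head; all cells not listed are blank. *)
Definition tape := (seq bool * bool * seq bool)%type.

Definition write_tape (b : bool) (t : tape) : tape :=
  let: (l, _, r) := t in (l, b, r).

Definition move_tape (d : move) (t : tape) : tape :=
  let: (l, s, r) := t in
  match d with
  | MoveLeft => (behead l, head false l, s :: r)
  | Stay => t
  | MoveRight => (s :: l, head false r, behead r)
  end.

Definition ones (t : tape) : nat :=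
  let: (l, s, r) := t in count id l + s + count id r.

Definition move_oracle_head (d : move) (h : nat) : nat :=
  match d with MoveLeft => h.-1 | Stay => h | MoveRight => h.+1 end.

Definition oracle_cell (X : set nat) (h : nat) : option bool :=
  if h is c.+1 then Some (c \in X) else None.

Record config (M : oracle_machine) := Config {
  cstate : 'I_(nstates M).+1;
  work_tape : tape;
  oracle_head : nat
}.

Definition next_action (M : oracle_machine) (X : set nat) (c : config M) :=
  transition M (cstate c, oracle_cell X (oracle_head c), (work_tape c).1.2).

Definition halted (M : oracle_machine) (X : set nat) (c : config M) : bool :=
  ~~ isSome (next_action X c).

(* A halted configuration is left unchanged. *)
Definition step (M : oracle_machine) (X : set nat) (c : config M) : config M :=
  if next_action X c is Some (q, b, d, e) then
    Config q (move_tape d (write_tape b (work_tape c)))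
           (move_oracle_head e (oracle_head c))
  else c.

(* The input n is written as n.+1 consecutive 1s, with the work head on the
   leftmost one; the output is the total number of 1s left on the work tape. *)
Definition init_config (M : oracle_machine) (n : nat) : config M :=
  Config ord0 ([::], true, nseq n true) 0.

Definition turing_functional (M : oracle_machine) (X : set nat) : pfun nat :=
  fun n y => exists k : nat,
    let c := iter k (@step M X) (init_config M n) in
    halted X c /\ ones (work_tape c) = y.

(* (n, x, l) is the triple <n, x, l>: the value x at n is obtained after l
   steps. *)
Definition triples := set (nat * bool * nat).

Definition partial_oracle (A : set nat) (O : triples) : Prop :=
  forall n l, (O (n, false, l) -> ~ A n) /\ (O (n, true, l) -> A n).

Definition oracle_pfun (O : triples) : pfun bool :=
  fun n x => exists l, O (n, x, l).

Definition triple_code (t : nat * bool * nat) : nat :=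
  let: (n, x, l) := t in CodeSeq.code [:: n; nat_of_bool x; l].

(* A machine accesses O by testing the membership of single triples; a query to
   bit n is a search through the triples (n, x, l), which the machine is free to
   interleave with anything else. *)
Definition functional_of_oracle (M : oracle_machine) (O : triples) : pfun nat :=
  turing_functional M (triple_code @` O).

Definition ii_reducible (B A : set nat) : Prop :=
  exists M : oracle_machine, forall O : triples,
    partial_oracle A O -> infinite_set (pdom (oracle_pfun O)) ->
    pagree (functional_of_oracle M O) (charfun B) /\
    infinite_set (pdom (functional_of_oracle M O)).

(* Main.v *)
Require Import Defs.
From mathcomp Require Import all_boot.
From mathcomp Require Import boolp classical_sets functions cardinality.

(** Let B0 be sufficiently generic and let M be a machine.  There are countably
    many partial oracles with infinite domain such that every A to which M
    reduces B0 admits one of them as a partial oracle.  Indeed, if infinitely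
    many one-bit extensions of a finite piece a of A make M err on B0, then A
    takes the opposite value at each of these bits, which determines A on an
    infinite set (or A contains one of the wrong extensions, and one recurses).
    Otherwise, by genericity, the extensions of a decide only finitely many bits
    of B0; a sparse infinite set of bits of A then lets M compute only finitely
    many values, a contradiction.  Given B0, it remains to choose B1 so as to
    disagree with the output of every machine run on any of these countably many
    partial oracles. *)

Set Implicit Arguments.
Unset Strict Implicit.
Unset Printing Implicit Defensive.

Local Open Scope classical_set_scope.

(** * Diagonalization against countably many partial functions *)

Lemma infinite_natP (S : set nat) :
  infinite_set S <-> forall N, exists2 n, N <= n & S n.
Proof.
split=> [Sinf N|Sunb /finite_seqP[s Ss]].
  apply: contrapT => Sbnd; apply/Sinf/(sub_finite_set _ (finite_II N)) => n Sn.
  rewrite /= ltnNge; apply/negP => leNn; apply: Sbnd; by exists n.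
have [n ltn Sn] := Sunb (\max_(i <- s) i).+1; move: Sn; rewrite Ss /= => sn.
by rewrite ltnNge (@leq_bigmax_seq _ s xpredT id n sn isT) in ltn.
Qed.

(** Each [R k] with infinite domain is met at a point of its own, chosen past all earlier points, so
    that the requirements do not interfere. *)
Lemma diagonalization_nat (R : nat -> pfun nat) :
  exists B, forall k, infinite_set (pdom (R k)) -> ~ pagree (R k) (charfun B).
Proof.
have /choice[F FP] (kN : nat * nat) : exists p : nat * nat,
    kN.2 <= p.1 /\ (infinite_set (pdom (R kN.1)) -> R kN.1 p.1 p.2).
  have [/infinite_natP/(_ kN.2)[m lem [y Ry]]|fin] :=
    pselect (infinite_set (pdom (R kN.1))); first by exists (m, y).
  by exists (kN.2, 0).
pose p := fix p k :=
  if k is j.+1 then F (j.+1, (p j).1.+1) else F (0, 0).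
have p_homo : {homo (fun k => (p k).1) : i j / i < j}.
  apply: homo_ltn => [j i k|k]; first exact: ltn_trans.
  by have [] := FP (k.+1, (p k).1.+1).
have p_inj i j : (p i).1 = (p j).1 -> i = j.
  by move=> eqp; case: (ltngtP i j) => // /p_homo; rewrite eqp ltnn.
(* The value 0 puts the point into the set and any other value keeps it out, so the characteristic
   function differs from the value either way. *)
exists [set m | exists2 k, (p k).1 = m & (p k).2 = 0] => k Rinf agree.
have Rp : R k (p k).1 (p k).2 by case: k Rinf {agree} => [|k] Rinf;
  [apply: (FP (0, 0)).2|apply: (FP (k.+1, (p k).1.+1)).2].
have := agree _ _ _ Rp erefl; case: (eqVneq (p k).2 0) => [y0|yN0].
  by rewrite mem_set ?y0 //; exists k.
rewrite memNset => [/eqP|[j /p_inj ->] /eqP]; exact/negP.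
Qed.

Lemma diagonalization (I : Type) (e : I -> nat) (R : I -> pfun nat) :
  injective e ->
  exists B, forall i, infinite_set (pdom (R i)) -> ~ pagree (R i) (charfun B).
Proof.
move=> e_inj.
have [B BP] := diagonalization_nat
  (fun k m y => exists2 i, e i = k & R i m y).
exists B => i Rinf agree; apply: (BP (e i)).
  by apply: sub_infinite_set Rinf => m [y Ry]; exists y, i.
by move=> m y z [j /e_inj ->]; exact: agree.
Qed.

(** * Coding of machines by numbers *)

Definition move_code (d : move) : nat :=
  match d with MoveLeft => 0 | Stay => 1 | MoveRight => 2 end.

Lemma move_code_inj : injective move_code.
Proof. by do 2!case. Qed.

(** States become plain numbers, so that the type of the listed table does not depend on
    [nstates M]. *)
Definition machine_code (M : oracle_machine) : nat :=
  pickle (nstates M,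
    [seq omap (fun o : 'I_(nstates M).+1 * bool * move * move =>
                 let: (q, b, d, e) := o in
                 (val q, b, move_code d, move_code e)) (transition M t)
     | t <- enum {: 'I_(nstates M).+1 * option bool * bool}]).

Lemma machine_code_inj : injective machine_code.
Proof.
move=> [n f] [n' f'] /(pcan_inj pickleK)[/= eqn]; subst n' => eqf.
congr OracleMachine; apply/ffunP => t; move: eqf => /eq_in_map/(_ t).
rewrite mem_enum => /(_ isT).
case: (f t) (f' t) => [[[[q b] d] e]|] [[[[q' b'] d'] e']|] //=.
by move=> [/val_inj-> -> /move_code_inj-> /move_code_inj->].
Qed.

(** * The use of an oracle computation *)

Lemma oracle_head_iter M (X : set nat) n k :
  oracle_head (iter k (@step M X) (init_config M n)) <= k.
Proof.
elim: k => [//|k IHk]; rewrite iterS; move: (iter _ _ _) IHk => c lec.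
rewrite /step; case: next_action => [[[[q b] d] []]|] //=.
- exact: leq_trans (leq_pred _) (leqW lec).
- exact: leqW.
- exact: leqW.
Qed.

Lemma next_action_local M (X Y : set nat) (c : config M) k :
  oracle_head c <= k -> (forall i, i < k -> (X i <-> Y i)) ->
  next_action X c = next_action Y c.
Proof.
rewrite /next_action; case: (oracle_head c) => [//|h] lthk eqXY /=.
by congr (transition _ (_, Some _, _)); apply: asbool_equiv_eq; exact: eqXY.
Qed.

Lemma iter_step_local M (X Y : set nat) n k : (forall i, i < k -> (X i <-> Y i)) ->
  iter k (@step M X) (init_config M n) = iter k (@step M Y) (init_config M n).
Proof.
elim: k => [//|k IHk] eqXY.
have eqk i : i < k -> (X i <-> Y i) by move=> ltik; apply/eqXY/ltnW.
by rewrite !iterS -IHk // /step (next_action_local (oracle_head_iter _ _ _ _) eqk).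
Qed.

Lemma ltn_triple_code n x l : n < triple_code (n, x, l).
Proof. by have /andP[] := CodeSeq.ltn_code [:: n; nat_of_bool x; l]. Qed.

Lemma triple_code_inj : injective triple_code.
Proof.
move=> [[n x] l] [[n' x'] l'] /(can_inj CodeSeq.codeK)[-> + ->].
by case: x x' => [] [].
Qed.

(** In [k] steps only bits below [k] of the coded oracle are scanned, and the code of a triple
    exceeds its first entry; so [u] is the number of steps. *)
Lemma use_principle M O m y : functional_of_oracle M O m y ->
  exists u, forall O' : triples,
    (forall n x l, n < u -> (O (n, x, l) <-> O' (n, x, l))) ->
    functional_of_oracle M O' m y.
Proof.
move=> [k [haltk <-]]; exists k => O' eqO; exists k.
have eqX i : i < k -> ((triple_code @` O) i <-> (triple_code @` O') i).
  by move=> ltik; split=> -[[[n x] l] Ot eqi]; exists (n, x, l) => //;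
    apply/eqO => //; apply: leq_trans (ltn_triple_code n x l) _;
    rewrite eqi ltnW.
rewrite -(iter_step_local _ _ eqX); split=> //.
by rewrite /halted -(next_action_local (oracle_head_iter _ _ _ _) eqX).
Qed.

(** * Finite pieces and countable families of partial oracles *)

Definition graph_oracle (S : set (nat * bool)) : triples :=
  [set t | S t.1 /\ t.2 = 0].

Definition cylinder (a : seq (nat * bool)) : set (set nat) :=
  [set A | {in a, forall p, p.2 = (p.1 \in A)}].

Definition reduces (M : oracle_machine) (B A : set nat) : Prop :=
  forall O : triples,
    partial_oracle A O -> infinite_set (pdom (oracle_pfun O)) ->
    pagree (functional_of_oracle M O) (charfun B) /\
    infinite_set (pdom (functional_of_oracle M O)).

Lemma partial_oracle_graph (A : set nat) (S : set (nat * bool)) :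
  (forall n x, S (n, x) -> x = (n \in A)) -> partial_oracle A (graph_oracle S).
Proof.
by move=> SA n l; split=> -[/= /SA]; [move=> + _ /mem_set => <-|
  move=> /esym/set_mem].
Qed.

(* A computation from finitely many bits of [A] survives when the oracle is
   completed by all the bits of [A] past its use. *)
Lemma functional_finite_correct M B A a m y : reduces M B A -> cylinder a A ->
  functional_of_oracle M (graph_oracle [set` a]) m y -> charfun B m y.
Proof.
move=> redA aA /use_principle[u use].
pose S := [set p | p \in a \/ u <= p.1 /\ p.2 = (p.1 \in A)].
have [||agree _] := redA (graph_oracle S).
- by apply: partial_oracle_graph => n x [/aA //|[]].
- apply/infinite_natP => N; exists (maxn u N); first exact: leq_maxr.
  by exists (maxn u N \in A), 0; split=> //; right; rewrite leq_maxl.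
- apply: agree; last by []; apply: use => n x l ltnu.
  split=> -[/= Sp ->]; split=> //; first by left.
  by case: Sp => // -[]; rewrite leqNgt ltnu.
Qed.

Definition covered (K : set (set nat)) : Prop :=
  exists O : nat -> triples, forall A, K A ->
    exists2 i, infinite_set (pdom (oracle_pfun (O i))) & partial_oracle A (O i).

Lemma covered_sub (K L : set (set nat)) : K `<=` L -> covered L -> covered K.
Proof. by move=> KL [O OP]; exists O => A /KL/OP. Qed.

Lemma covered_bigcup (K : nat -> set (set nat)) :
  (forall i, covered (K i)) -> covered (\bigcup_i K i).
Proof.
move=> /choice[O OP].
exists (fun n => if unpickle n is Some (i, j) then O i j else set0).
move=> A [i _ /OP[j Oinf OA]]; exists (pickle (i, j)); by rewrite pickleK.
Qed.

Lemma covered_setU (K L : set (set nat)) :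
  covered K -> covered L -> covered (K `|` L).
Proof.
move=> Kc Lc; apply: (covered_sub (L := \bigcup_i if i is 0 then K else L)).
  by move=> A [KA|LA]; [exists 0|exists 1].
by apply: covered_bigcup => -[].
Qed.

Lemma covered_partial_oracle (O : triples) :
  infinite_set (pdom (oracle_pfun O)) -> covered [set A | partial_oracle A O].
Proof. by move=> Oinf; exists (fun=> O) => A OA; exists 0. Qed.

(** Either [A] agrees with some [s N] and lies in its cylinder, or the flipped bits, at unbounded
    positions, form a partial oracle for [A]. *)
Lemma covered_step (K : set (set nat)) (a : seq (nat * bool))
    (s : nat -> nat * bool) :
  (forall N, N <= (s N).1) -> (forall N, covered (K `&` cylinder (s N :: a))) ->
  covered (K `&` cylinder a).
Proof.
move=> s_unb sc; pose S := [set p | exists N, p = ((s N).1, ~~ (s N).2)].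
apply: (covered_sub (L := [set A | partial_oracle A (graph_oracle S)] `|`
                          \bigcup_N (K `&` cylinder (s N :: a)))); last first.
  apply: covered_setU; last exact: covered_bigcup.
  apply: covered_partial_oracle; apply/infinite_natP => N.
  exists (s N).1 => //; exists (~~ (s N).2), 0; split=> //; by exists N.
move=> A [KA aA].
have [[N sA]|sNA] := pselect (exists N, (s N).2 = ((s N).1 \in A)).
  right; exists N => //; split=> // p; rewrite inE => /orP[/eqP->//|]; exact: aA.
left; apply: partial_oracle_graph => _ _ [N [-> ->]].
have : (s N).2 <> ((s N).1 \in A) by move=> sA; apply: sNA; exists N.
by case: (s N).2; case: (_ \in _).
Qed.

(* [decides M a] closes the output of [M] on [a] under passing to any value that
   is decided by infinitely many one-bit extensions of [a]: if such extensions
   decide only values that [a] does not decide, these values are unbounded. *)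
Inductive decides (M : oracle_machine) :
    seq (nat * bool) -> nat -> nat -> Prop :=
| decides_functional a m y :
    functional_of_oracle M (graph_oracle [set` a]) m y -> decides M a m y
| decides_limit a m y (s : nat -> nat * bool) :
    (forall N, N <= (s N).1) -> (forall N, decides M (s N :: a) m y) ->
    decides M a m y.

Lemma covered_decides M B a m y : decides M a m y -> ~ charfun B m y ->
  covered (reduces M B `&` cylinder a).
Proof.
elim=> {a m y} [a m y Phiay yNB|a m y s s_unb _ IH yNB].
  (* A wrong output leaves no set to cover, so any family will do. *)
  exists (fun=> set0) => A [redA aA]; case: yNB.
  exact: functional_finite_correct redA aA Phiay.
by apply: (covered_step s_unb) => N; exact: IH.
Qed.

Definition extension_values (M : oracle_machine) (a : seq (nat * bool))
    (N : nat) : pfun nat :=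
  fun m y => exists p, N <= p.1 /\ decides M (p :: a) m y.

Lemma covered_extension_values M B a :
  (forall N, ~ pagree (extension_values M a N) (charfun B)) ->
  covered (reduces M B `&` cylinder a).
Proof.
move=> disagree.
have /choice[s sP] N : exists p, N <= p.1 /\
    covered (reduces M B `&` cylinder (p :: a)).
  apply: contrapT => none; apply: (disagree N) => m y _ [p [leNp dec]] ->.
  apply: contrapT => yNB; apply: none; exists p; split=> //.
  exact: covered_decides dec yNB.
by apply: (covered_step (s := s)) => N; have [] := sP N.
Qed.

(** The hypotheses express the genericity of [B]. Finite pieces being countably many, it remains to
    refute an [A] that lies in no covered cylinder. *)
Lemma covered_reduces M B :
  (infinite_set (pdom (decides M [::])) ->
   ~ pagree (decides M [::]) (charfun B)) ->
  (forall a N, infinite_set (pdom (extension_values M a N)) ->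
   ~ pagree (extension_values M a N) (charfun B)) ->
  covered (reduces M B).
Proof.
move=> disagree_nil disagree_ext.
pose L n := [set A | exists a, [/\ unpickle n = Some a,
  covered (reduces M B `&` cylinder a) & (reduces M B `&` cylinder a) A]].
apply: (covered_sub (L := \bigcup_n L n)); last first.
  apply: covered_bigcup => n.
  have [[a [na ca]]|none] := pselect (exists a : seq (nat * bool),
    unpickle n = Some a /\ covered (reduces M B `&` cylinder a)).
    by apply: covered_sub ca => A [b []]; rewrite na => -[<-].
  by exists (fun=> set0) => A [a [na ca _]]; case: none; exists a.
move=> A redA; apply: contrapT => notL.
have not_covered a : cylinder a A -> ~ covered (reduces M B `&` cylinder a).
  move=> aA ca; apply: notL; exists (pickle a) => //; exists a.
  by rewrite pickleK.
have correct a m y : cylinder a A -> decides M a m y -> charfun B m y.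
  move=> /not_covered nca dec; apply: contrapT => yNB.
  exact/nca/covered_decides/yNB.
have bounded a : cylinder a A -> exists N C, forall p m y,
    N <= p.1 -> decides M (p :: a) m y -> m < C.
  move=> aA; have [N agreeN] : exists N,
      pagree (extension_values M a N) (charfun B).
    apply: contrapT => none; apply: (not_covered a aA).
    by apply: covered_extension_values => N agreeN; apply: none; exists N.
  exists N; apply: contrapT => unb; apply: (disagree_ext a N) => //.
  apply/infinite_natP => C; apply: contrapT => none; apply: unb; exists C.
  move=> p m y leNp dec; rewrite ltnNge; apply/negP => leCm; apply: none.
  by exists m => //; exists y, p.
have [C0 boundC0] : exists C, forall m y, decides M [::] m y -> m < C.
  apply: contrapT => unb; apply: disagree_nil.
    apply/infinite_natP => C; apply: contrapT => none; apply: unb; exists C.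
    move=> m y dec; rewrite ltnNge; apply/negP => leCm; apply: none.
    by exists m => //; exists y.
  by move=> m y _ dec ->; exact: (correct [::]) dec.
(* An inert finite piece of [A] decides no value from [C0] on.  A value decided
   by infinitely many extensions is decided by the piece itself, so all late
   enough bits of [A] keep it inert. *)
pose inert a := cylinder a A /\ forall m y, decides M a m y -> m < C0.
have inert_ext a : exists N, inert a ->
    forall n, N <= n -> inert ((n, n \in A) :: a).
  have [[aA boundC0a]|] := pselect (inert a); last by exists 0.
  have [N1 [C1 boundC1]] := bounded a aA.
  have cons_cyl n : cylinder ((n, n \in A) :: a) A.
    by move=> p; rewrite inE => /orP[/eqP->//|]; exact: aA.
  have /choice[b bP] m : exists b, C0 <= m -> forall n, b <= n ->
      ~ decides M ((n, n \in A) :: a) m (m \in B).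
    apply: contrapT => none.
    have leC0m : C0 <= m.
      by rewrite leqNgt; apply/negP => ltm; apply: none; exists 0;
        rewrite leqNgt ltm.
    have /choice[s sP] N : exists n, N <= n /\
        decides M ((n, n \in A) :: a) m (m \in B).
      apply: contrapT => noneN; apply: none; exists N => _ n leNn dec.
      by apply: noneN; exists n.
    suff /boundC0a : decides M a m (m \in B) by rewrite ltnNge leC0m.
    by apply: (@decides_limit _ _ _ _ (fun N => (s N, s N \in A))) => N;
      have [] := sP N.
  (* Past [N1] only arguments below [C1] are decided, so finitely many bounds [b m] are enough. *)
  exists (maxn N1 (\max_(m < C1) b m)) => _ n.
  rewrite geq_max => /andP[leN1n /bigmax_leqP leb]; split=> // m y dec.
  rewrite ltnNge; apply/negP => leC0m.
  have ltmC1 := boundC1 (n, n \in A) m y leN1n dec.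
  apply: (bP m leC0m n); first exact: (leb (Ordinal ltmC1)).
  by rewrite -(correct _ _ _ (cons_cyl n) dec).
have /choice[f fP] := inert_ext.
(* The maximum with [k] makes the positions unbounded, and no position below [k] is added from stage
   [k] on. *)
pose next k a := maxn (f a) k.
pose path := fix path k : seq (nat * bool) := if k is j.+1
  then (next j (path j), next j (path j) \in A) :: path j else [::].
have path_inert k : inert (path k).
  elim: k => [|k IHk]; first by split.
  by apply: (fP (path k)) => //; exact: leq_maxl.
have path_mono j k p : p \in path j -> j <= k -> p \in path k.
  move=> pj /subnKC <-; elim: (k - j) => [|i IHi]; first by rewrite addn0.
  by rewrite addnS inE IHi orbT.
have path_late j k p : p \in path j -> p.1 < k -> p \in path k.
  elim: j => [//|j IHj]; rewrite inE => /orP[/eqP -> /= ltk|/IHj]; last exact.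
  apply: (path_mono j.+1); first exact: mem_head.
  by apply: leq_ltn_trans ltk; exact: leq_maxr.
pose S := [set p | exists k, p \in path k].
have [||_ /infinite_natP/(_ C0)[m leC0m [y Phi]]] := redA (graph_oracle S).
- by apply: partial_oracle_graph => n x [k]; apply: (path_inert k).1.
- apply/infinite_natP => N; exists (next N (path N)); first exact: leq_maxr.
  exists (next N (path N) \in A), 0; split=> //; exists N.+1.
  exact: mem_head.
(* Below the use [u], [S] coincides with [path u], which is inert and so has no output at [m]. *)
have [u use] := use_principle Phi.
suff /decides_functional/(path_inert u).2 :
    functional_of_oracle M (graph_oracle [set` path u]) m y.
  by rewrite ltnNge leC0m.
apply: use => n x l ltnu; split=> -[/= Sp ->]; split=> //; last by exists u.
by case: Sp => k /path_late; apply.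
Qed.

Theorem theorem5p1 :
  exists B0 B1 : set nat,
    ~ exists A : set nat, ii_reducible B0 A /\ ii_reducible B1 A.
Proof.
(* [None] stands for the empty piece, [Some (a, N)] for the one-bit extensions of [a] from [N]
   on. *)
pose R0 (i : oracle_machine * option (seq (nat * bool) * nat)) : pfun nat :=
  if i.2 is Some (a, N) then extension_values i.1 a N else decides i.1 [::].
have e0_inj : injective (fun i : oracle_machine *
    option (seq (nat * bool) * nat) => pickle (machine_code i.1, i.2)).
  by move=> [M o] [M' o'] /(pcan_inj pickleK)[/machine_code_inj-> ->].
have [B0 B0P] := diagonalization R0 e0_inj.
have /choice[O OP] M : covered (reduces M B0).
  by apply: covered_reduces => [|a N];
    [exact: (B0P (M, None))|exact: (B0P (M, Some (a, N)))].
(* The first machine, meant to reduce [B0], selects the family of oracles; the second, meant to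
   reduce [B1], is run on them. *)
pose R1 (i : oracle_machine * oracle_machine * nat) : pfun nat :=
  functional_of_oracle i.1.2 (O i.1.1 i.2).
have e1_inj : injective (fun i : oracle_machine * oracle_machine * nat =>
    pickle (machine_code i.1.1, machine_code i.1.2, i.2)).
  move=> [[M N] i] [[M' N'] i'] /(pcan_inj pickleK).
  by move=> [/machine_code_inj-> /machine_code_inj-> ->].
have [B1 B1P] := diagonalization R1 e1_inj.
exists B0, B1 => -[A [[M0 red0] [M1 red1]]].
have [i Oinf OA] := OP M0 A red0.
have [agree inf] := red1 _ OA Oinf.
exact: (B1P (M0, M1, i)) inf agree.
Qed.
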